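(* Let $m\ge 1$ be an integer, $N=43^m$, $f=\phi(43^m)/6$ and $q=11^f$ (here $\mathrm{ord}_{43^m}(11)=\phi(43^m)/6$, so $N\mid q-1$). Let $\gamma$ be a fixed primitive element of $\mathbb{F}_q$, let $C_i=\{\gamma^{i+jN}\mid 0\le j\le\frac{q-1}{N}-1\}$ for $0\le i\le N-1$, and let $D=\bigcup_{i=0}^{43^{m-1}-1}C_i$. Then $\mathrm{Cay}(\mathbb{F}_q,D)$ is a strongly regular graph.
   Context: $\phi$ is the Euler totient function and $\mathrm{ord}_n(a)$ is the multiplicative order of $a$ modulo $n$. For $D\subseteq\mathbb{F}_q^*$ with $-D=D$, $\mathrm{Cay}(\mathbb{F}_q,D)$ is the graph with vertex set $\mathbb{F}_q$ in which two vertices are adjacent if and only if their difference belongs to $D$. A strongly regular graph srg$(v,k,\lambda,\mu)$ is a simple undirected regular graph of order $v$ and valency $k$, neither complete nor edgeless, such that any two adjacent vertices have exactly $\lambda$ common neighbors and any two (distinct) nonadjacent vertices have exactly $\mu$ common neighbors; connectedness is not required. *)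

(* Defs.v *)
From HB Require Import structures.
From mathcomp Require Import all_boot all_order all_algebra all_fingroup.
From mathcomp Require Import all_solvable all_field.

Set Implicit Arguments.
Unset Strict Implicit.
Unset Printing Implicit Defensive.

Import GRing.Theory.
Local Open Scope ring_scope.

(* [is_mult_order n a d]: d is ord_n(a), the least d > 0 with a^d = 1 mod n. *)
Definition is_mult_order (n a d : nat) : Prop :=
  [/\ (0 < d)%N,
      (a ^ d = 1 %[mod n])%N
    & forall e : nat, (0 < e)%N -> (a ^ e = 1 %[mod n])%N -> (d <= e)%N].

(* The class C_i; it has the intended meaning when N divides #|F| - 1. *)
Definition cyclotomic_class (F : finFieldType) (gamma : F) (N i : nat)
  : {set F} :=
  [set gamma ^+ (i + j * N)%N | j : 'I_(#|F|.-1 %/ N)].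

(* Symmetry of this relation, i.e. -D = D, and its irreflexivity, i.e.
   0 \notin D, are not assumed here: they are required by [srg] below. *)
Definition Cay (F : finFieldType) (D : {set F}) : rel F :=
  fun x y => x - y \in D.

Definition nbhd (T : finType) (e : rel T) (x : T) : {set T} :=
  [set y | e x y].

Record srg (T : finType) (e : rel T) (v k lambda mu : nat) : Prop := Srg {
  srg_sym : symmetric e;
  srg_irr : irreflexive e;
  srg_order : #|T| = v;
  srg_valency : forall x : T, #|nbhd e x| = k;
  srg_not_complete : exists x y : T, x != y /\ ~~ e x y;
  srg_not_edgeless : exists x y : T, e x y;
  srg_adj : forall x y : T, e x y -> #|nbhd e x :&: nbhd e y| = lambda;
  srg_nonadj : forall x y : T,
    x != y -> ~~ e x y -> #|nbhd e x :&: nbhd e y| = mu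
}.

Definition strongly_regular (T : finType) (e : rel T) : Prop :=
  exists v k lambda mu : nat, srg e v k lambda mu.

(* Main.v *)
Require Import Defs.
From HB Require Import structures.
From mathcomp Require Import all_boot all_order all_algebra all_fingroup.
From mathcomp Require Import all_solvable all_field.
From mathcomp Require Import zify ring.

(** The nontrivial eigenvalues of the graph are the sums
    theta x = \sum_(d in D) psi (x * d), for the additive character psi of F
    attached to the trace Tr.  Since D is stable under F_11^*,
    theta x = |D| - 11 u / 10, where u counts the d in D with Tr (x d) <> 0.

    Write f = 2c + 1.  Lifting F to characteristic 0 and expanding
    Tr (x d) ^ (10 * 11 ^ n) in powers of the Teichmueller lift of d, a monomial
    survives the summation over D only if its exponent is (q - 1) k / N with
    43 not dividing k, or is divisible by q - 1; the base 11 digit sum of such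
    an exponent is at least 10 c, as the orbits of multiplication by 11 on
    Z/43 have sums at least 3 * 43.  As in Stickelberger's and McEliece's
    theorems, this forces 11 ^ (c - 1) to divide u, and therefore
    theta x = |D| - 11 ^ c v with v an integer.

    The first two moments of theta are given by Parseval.  They say that
    \sum_(x != 0) (w - v) (w + 1 - v) = 0, where 43 w + 21 = 11 ^ (c + 1).  All
    terms are nonnegative, so theta takes only two values at x != 0, and Fourier
    inversion of theta ^ 2 shows that the graph is strongly regular.  No Gauss
    sum is evaluated. *)

Set Implicit Arguments.
Unset Strict Implicit.
Unset Printing Implicit Defensive.

Import GRing.Theory.
Local Open Scope ring_scope.

(** * Residues and weights of exponents *)

Section Weight.

Local Open Scope nat_scope.

(* The representative of a positive [e] modulo [M] in {1, ..., M}: a positive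
   multiple of [M] is represented by [M], not by [0]. *)
Definition posmod (M e : nat) : nat := (e.-1 %% M).+1.

Lemma posmod_le_id M e : 0 < e -> posmod M e <= e.
Proof. by case: e => // e _; rewrite /posmod /= ltnS leq_mod. Qed.

Lemma posmod_small M e : 0 < e <= M -> posmod M e = e.
Proof. by case: e => // e /= lt_eM; rewrite /posmod /= modn_small. Qed.

Lemma posmodDM M e k : 0 < e -> posmod M (e + k * M) = posmod M e.
Proof. by case: e => // e _; rewrite /posmod addSn /= addnC modnMDl. Qed.

Lemma posmodE M e : 0 < e -> exists k, e = posmod M e + k * M.
Proof.
case: e => // e _; exists (e %/ M).
by rewrite /posmod /= {1}(divn_eq e M) addSn addnC.
Qed.

Lemma posmod_mod M e : ~~ (M %| e) -> posmod M e = e %% M.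
Proof.
case: M => [|M]; first by case: e => // e _; rewrite /posmod !modn0.
move=> ndvd; have e_gt0 : 0 < e by case: e ndvd; rewrite ?dvdn0.
have r_gt0 : 0 < e %% M.+1 by rewrite lt0n.
rewrite {1}(divn_eq e M.+1) addnC posmodDM // posmod_small //.
by rewrite r_gt0 ltnW // ltn_mod.
Qed.

Lemma posmod_dvd M e : 0 < M -> 0 < e -> M %| e -> posmod M e = M.
Proof.
move=> M_gt0 e_gt0 /dvdnP[[|k] De]; first by rewrite De in e_gt0.
by rewrite De mulSn posmodDM // posmod_small // M_gt0 leqnn.
Qed.

(** The right-hand side is positive and congruent to [a + b] modulo [M], and [posmod] picks the
    least such number. *)
Lemma posmodD M a b : 0 < a -> 0 < b ->
  posmod M (a + b) <= posmod M a + posmod M b.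
Proof.
move=> /(posmodE M)[k {1}->] /(posmodE M)[l {1}->].
rewrite addnACA -mulnDl posmodDM // ?addn_gt0 //.
by rewrite posmod_le_id // addn_gt0.
Qed.

Variables p f : nat.
Hypotheses (p_gt1 : 1 < p) (f_gt0 : 0 < f).
Let M := (p ^ f).-1.

Let pf_gt1 : 1 < p ^ f.
Proof. by rewrite -(exp1n f) ltn_exp2r. Qed.

Let M_gt0 : 0 < M. Proof. by rewrite /M; lia. Qed.

(* Up to the factor [(p ^ f - 1) / (p - 1)], a lower bound for the sum of the
   base [p] digits of [e]. *)
Definition weight (e : nat) : nat := \sum_(i < f) posmod M (e * p ^ i).

Lemma weightD a b : 0 < a -> 0 < b -> weight (a + b) <= weight a + weight b.
Proof.
move=> a_gt0 b_gt0; rewrite /weight -big_split /=; apply: leq_sum => i _.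
by rewrite mulnDl posmodD // muln_gt0 ?a_gt0 ?b_gt0 expn_gt0 ltnW.
Qed.

(** Since [p ^ f] is 1 modulo [M], replacing [e] by [e * p] permutes the summands cyclically. *)
Lemma weight_mulp e : 0 < e -> weight (e * p) = weight e.
Proof.
move=> e_gt0; rewrite /weight.
have [n Df] : exists n, f = n.+1 by exists f.-1; rewrite prednK.
rewrite Df big_ord_recr [RHS]big_ord_recl /= addnC; congr (_ + _).
  have -> : e * p * p ^ n = e * p ^ 0 + e * M.
    by rewrite -mulnDr expn0 add1n /M prednK ?(ltnW pf_gt1) // Df expnS mulnA.
  by rewrite posmodDM ?expn0 ?muln1.
by apply: eq_bigr => i _; rewrite -mulnA -expnS.
Qed.

(** By invariance under multiplication by [p] this is the weight of 1, a geometric sum in [p]. *)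
Lemma weight_expp j : weight (p ^ j) * p.-1 = M.
Proof.
have -> : weight (p ^ j) = weight 1.
  elim: j => [|j IHj] //; rewrite expnSr weight_mulp ?IHj //.
  by rewrite expn_gt0 ltnW.
rewrite /M predn_exp mulnC; congr (_ * _); apply: eq_bigr => i _.
rewrite mul1n posmod_small // expn_gt0 (ltnW p_gt1) /=.
by rewrite -ltnS /M prednK ?(ltnW pf_gt1) // ltn_exp2l.
Qed.

Lemma weight_dvd e : 0 < e -> M %| e -> weight e = f * M.
Proof.
move=> e_gt0 dvd_e; rewrite /weight.
rewrite (eq_bigr (fun _ => M)) ?sum_nat_const ?card_ord // => i _.
by rewrite posmod_dvd ?dvdn_mulr // muln_gt0 e_gt0 expn_gt0 ltnW.
Qed.

Lemma weight_mul K N k : K * N = M -> coprime p N -> ~~ (N %| k) ->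
  weight (K * k) = K * \sum_(i < f) (k * p ^ i) %% N.
Proof.
move=> KN co_pN ndvd; rewrite /weight big_distrr /=; apply: eq_bigr => i _.
have K_gt0 : 0 < K by case: (K) KN M_gt0 => // <-.
rewrite -mulnA posmod_mod -KN ?muln_modr // dvdn_pmul2l //.
by rewrite Gauss_dvdl // coprime_sym coprimeXl.
Qed.

End Weight.

(* [I k] plays the role of the [k]-th power of the maximal ideal of the ring
   of integers of the unramified extension of Q_p with residue field [F]. *)
Record padic_filtration (p : nat) (A : comNzRingType) (F : fieldType)
    (red : {rmorphism A -> F}) (I : nat -> A -> Prop) : Prop := PadicFiltration {
  filtD : forall k x y, I k x -> I k y -> I k (x + y);
  filtM : forall a b x y, I a x -> I b y -> I (a + b)%N (x * y);
  filt_le : forall a b x, (a <= b)%N -> I b x -> I a x;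
  filtT : forall x, I 0%N x;
  filt0 : forall k, I k 0;
  filtp : I 1%N p%:R;
  filt_red : forall x, red x = 0 <-> I 1%N x;
  filt_nat : forall k n, I k n%:R -> (p ^ k %| n)%N
}.

(** * Congruences in a filtered ring *)

Section Filtration.

Variables (p : nat) (A : comNzRingType) (F : fieldType).
Variables (red : {rmorphism A -> F}) (I : nat -> A -> Prop).
Hypotheses (p_pr : prime p) (hI : padic_filtration p red I).

Lemma filtMl k x y : I k y -> I k (x * y).
Proof. by move=> Iy; apply: (filtM hI (a := 0)) => //; apply: filtT hI _. Qed.

Lemma filtMr k x y : I k x -> I k (x * y).
Proof. by rewrite mulrC; apply: filtMl. Qed.

Lemma filtN k x : I k x -> I k (- x).
Proof. by rewrite -mulN1r; apply: filtMl. Qed.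

Lemma filtB k x y : I k x -> I k y -> I k (x - y).
Proof. by move=> Ix /filtN; apply: (filtD hI). Qed.

Lemma filt_sum k (T : Type) (r : seq T) (P : pred T) (G : T -> A) :
  (forall i, P i -> I k (G i)) -> I k (\sum_(i <- r | P i) G i).
Proof.
by move=> IG; elim/big_rec: _ => [|i x Pi Ix]; [apply: filt0 hI _|apply: filtD hI _ _ _ _ _; auto].
Qed.

Lemma filtX k x n : (0 < n)%N -> I k x -> I k (x ^+ n).
Proof. by case: n => // n _ Ix; rewrite exprS; apply: filtMr. Qed.

Lemma filt_expn k n x : I k x -> I (k * n)%N (x ^+ n).
Proof.
move=> Ix; elim: n => [|n IHn]; first by rewrite muln0; apply: filtT hI _.
by rewrite exprS mulnS; apply: filtM hI _ _ _ _ _ _.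
Qed.

Lemma red_p : red p%:R = 0.
Proof. exact/(filt_red hI)/(filtp hI). Qed.

(** The cofactor of [x - y] in [x ^+ p - y ^+ p] reduces to [p] times a power of [red y], that is to
    0, which gains one step. *)
Lemma filt_expB_pexp k x y :
  (0 < k)%N -> I k (x - y) -> I k.+1 (x ^+ p - y ^+ p).
Proof.
move=> k_gt0 Ixy; rewrite subrXX -addn1; apply: (filtM hI) => //.
have /(filt_red hI)/eqP := filt_le hI k_gt0 Ixy.
rewrite rmorphB subr_eq0 => /eqP Exy; apply/(filt_red hI).
rewrite rmorph_sum /= (eq_bigr (fun _ => red y ^+ p.-1)) => [|i _].
  by rewrite sumr_const card_ord -mulr_natl -(rmorph_nat red) red_p mul0r.
rewrite rmorphM !rmorphXn Exy -exprD /=; congr (_ ^+ _).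
by have := ltn_ord i; lia.
Qed.

Lemma filt_expB_pexpn n x y :
  I 1%N (x - y) -> I n.+1 (x ^+ (p ^ n) - y ^+ (p ^ n)).
Proof.
move=> Ixy; elim: n => [|n IHn] //.
by rewrite expnSr !exprM; apply: filt_expB_pexp.
Qed.

(* A geometric sum vanishes to the same order as [y ^+ n - 1] unless its ratio
   is congruent to 1, since then [y - 1] is invertible modulo every [I k]. *)
Lemma filt_geom (surj : forall x, exists y, red y = x) k n y :
  red y != 1 -> I k (y ^+ n - 1) -> I k (\sum_(i < n) y ^+ i).
Proof.
move=> y1 Iyn; set S := \sum_(i < n) _.
have {Iyn} IS : I k ((y - 1) * S) by rewrite -subrX1.
have [z Dz] := surj (red (y - 1))^-1.
have Iu : I 1%N (1 - z * (y - 1)).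
  apply/(filt_red hI); rewrite rmorphB rmorph1 rmorphM Dz mulVf ?subrr //.
  by rewrite rmorphB rmorph1 subr_eq0.
have IuS : I k ((1 - z * (y - 1)) ^+ k * S).
  by apply: filtMr; have := filt_expn k Iu; rewrite mul1n.
have : I k (S - (1 - z * (y - 1)) ^+ k * S).
  rewrite -{1}[S]mul1r -mulrBl -opprB subrX1; set G := \sum_(i < _) _.
  have -> : - ((1 - z * (y - 1) - 1) * G) * S = z * G * ((y - 1) * S) by ring.
  exact: filtMl.
by move=> /(filtD hI) - /(_ _ IuS); rewrite subrK.
Qed.

(** * Polynomials of bounded weight *)

Section BoundedWeight.

Variable f : nat.
Hypothesis f_gt0 : (0 < f)%N.
Let M := (p ^ f).-1.

(* A coefficient in [I v] lowers the weight of its monomial by [v * M]; in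
   units of [M / (p - 1)], the weight of [c * 'X^e] has to be at most [k]. *)
Inductive weight_le (k : nat) : {poly A} -> Prop :=
| weight_le0 : weight_le k 0
| weight_leD P v c e : (0 < e)%N -> I v c ->
    (weight p f e * p.-1 <= (k + v * p.-1) * M)%N ->
    weight_le k P -> weight_le k (c%:P * 'X^e + P).

Lemma weight_le_mono k v c e : (0 < e)%N -> I v c ->
    (weight p f e * p.-1 <= (k + v * p.-1) * M)%N -> weight_le k (c%:P * 'X^e).
Proof.
move=> e_gt0 Ic le_e; rewrite -[_ * _]addr0.
exact: weight_leD le_e (weight_le0 k).
Qed.

Lemma weight_le_add k P Q : weight_le k P -> weight_le k Q -> weight_le k (P + Q).
Proof.
elim=> [|R v c e e_gt0 Ic le_e _ IH] WQ; first by rewrite add0r.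
by rewrite -addrA; apply: (weight_leD e_gt0 Ic le_e); apply: IH.
Qed.

Lemma weight_leMn k P n : weight_le k P -> weight_le k (P *+ n).
Proof.
move=> WP; elim: n => [|n IHn]; first by rewrite mulr0n; apply: weight_le0.
by rewrite mulrS; apply: weight_le_add.
Qed.

Lemma weight_le_sum k (T : Type) (r : seq T) (P : pred T) (G : T -> {poly A}) :
  (forall i, P i -> weight_le k (G i)) -> weight_le k (\sum_(i <- r | P i) G i).
Proof.
move=> WG; elim/big_rec: _ => [|i x Pi Wx]; first exact: weight_le0.
by apply: weight_le_add; auto.
Qed.

Lemma weight_leM a b P Q :
  weight_le a P -> weight_le b Q -> weight_le (a + b) (P * Q).
Proof.
move=> WP WQ; elim: WP => [|R v c e e_gt0 Ic le_e _ IH].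
  by rewrite mul0r; apply: weight_le0.
rewrite mulrDl; apply: weight_le_add => {R IH}//.
elim: WQ => [|R w d g g_gt0 Id le_g _ IH].
  by rewrite mulr0; apply: weight_le0.
rewrite mulrDr; apply: weight_le_add => {R IH}//.
rewrite mulrACA -exprD -polyCM.
apply: (weight_le_mono (v := v + w)); first by rewrite addn_gt0 e_gt0.
  exact: filtM hI _ _ _ _ _ _.
have := leq_mul (weightD f (prime_gt1 p_pr) e_gt0 g_gt0) (leqnn p.-1).
move/leq_trans; apply; rewrite mulnDl [((v + w) * _)%N]mulnDl addnACA [leqRHS]mulnDl.
exact: leq_add.
Qed.

Lemma weight_leX k n P :
  (0 < n)%N -> weight_le k P -> weight_le (k * n) (P ^+ n).
Proof.
case: n => // n _ WP; elim: n => [|n IHn]; first by rewrite muln1 expr1.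
by rewrite exprS mulnS; apply: weight_leM.
Qed.

(** The factor [p] raises the level [v] of each coefficient by 1, which is worth [p.-1] units of
    weight. *)
Lemma weight_le_p k P : weight_le (k + p.-1) P -> weight_le k (P *+ p).
Proof.
elim=> [|R v c e e_gt0 Ic le_e _ IH]; first by rewrite mul0rn; apply: weight_le0.
rewrite mulrnDl; apply: weight_le_add => //.
rewrite -mulrnAl -polyCMn -mulr_natr; apply: (weight_le_mono (v := v + 1)) => //.
  by apply: filtM hI _ _ _ _ _ _ => //; apply: filtp hI.
by rewrite addn1 mulSn addnA.
Qed.

(* The mixed terms of the binomial expansion have weight at most [p], and
   their coefficients are divisible by [p], which lowers this to 1. *)
Lemma weight_le1_pexp P : weight_le 1 P -> weight_le 1 (P ^+ p).
Proof.
have p_gt0 := prime_gt0 p_pr.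
elim=> [|R v c e e_gt0 Ic le_e WR IH].
  by rewrite expr0n eqn0Ngt p_gt0; apply: weight_le0.
rewrite exprDn -(prednK p_gt0) big_ord_recl big_ord_recr /=.
rewrite !prednK // expr0 mulr1 bin0 subn0 /bump leq0n add1n prednK // subnn binn.
rewrite expr0 mul1r !mulr1n addrCA addrC; apply: weight_le_add.
  apply: weight_le_add => //.
  rewrite exprMn -polyC_exp -exprM; apply: (weight_le_mono (v := v)).
  - by rewrite muln_gt0 e_gt0.
  - exact: filtX.
  - by rewrite weight_mulp // prime_gt1.
apply: weight_le_sum => i _; have lt_ip := ltn_ord i.
have /dvdnP[u ->] : (p %| 'C(p, bump 0 i))%N.
  by apply: prime_dvd_bin => //; rewrite /bump; lia.
rewrite mulrnA; apply/weight_le_p/weight_leMn.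
have WM := weight_le_mono e_gt0 Ic le_e.
have Wp : weight_le (1 * (p - bump 0 i) + 1 * bump 0 i)
    ((c%:P * 'X^e) ^+ (p - bump 0 i) * R ^+ bump 0 i).
  by apply: weight_leM; apply: weight_leX => //; rewrite /bump; lia.
have -> : (1 + p.-1 = 1 * (p - bump 0 i) + 1 * bump 0 i)%N; last by [].
by rewrite /bump; lia.
Qed.

Lemma weight_le1_pexpn n P : weight_le 1 P -> weight_le 1 (P ^+ (p ^ n)).
Proof.
by move=> WP; elim: n => [|n IHn] //; rewrite expnSr exprM; apply: weight_le1_pexp.
Qed.

End BoundedWeight.

End Filtration.

(** * The prime field, and a filtration on integral polynomials *)

Lemma frobenius_fixed_natr (F : fieldType) p (x : F) :
  p \in [pchar F] -> x ^+ p = x -> exists n : 'I_p, x = n%:R.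
Proof.
move=> chF Dx; have p_pr := pcharf_prime chF.
suff /existsP[n /eqP] : [exists n : 'I_p, x == n%:R] by exists n.
apply: contraT => /existsPn/= nx.
(* Otherwise [x] and the [p] elements of the prime field would be too many roots of ['X^p - 'X]. *)
pose s := x :: [seq (i : nat)%:R | i : 'I_p].
have /max_poly_roots : ('X^p - 'X : {poly F}) != 0.
  by rewrite -size_poly_eq0 size_polyDl size_polyXn // size_polyN size_polyX ltnS prime_gt1.
move=> /(_ s); rewrite size_polyDl size_polyXn ?size_polyN ?size_polyX ?ltnS ?prime_gt1 //=.
rewrite size_map size_enum_ord ltnn => -> //.
  rewrite /root !hornerE Dx subrr eqxx /=; apply/allP => _ /mapP[i _ ->].
  by rewrite /root !hornerE -(pFrobenius_autE chF) pFrobenius_aut_nat subrr.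
apply/andP; split; first by apply/mapP => -[i _ Dxi]; case/eqP: (nx i).
rewrite map_inj_uniq ?enum_uniq // => i j /eqP Eij; apply/val_inj => /=.
wlog le_ij: i j Eij / (i <= j)%N => [IH|].
  by case/orP: (leq_total i j) => [/IH->//|/IH<-//]; rewrite eq_sym.
move: Eij; rewrite eq_sym -subr_eq0 -natrB // -(dvdn_pcharf chF) => dvd_p.
have := ltn_ord j; case: (posnP (j - i)) => [|/dvdn_leq/(_ dvd_p)]; lia.
Qed.

Lemma intr_eq0_pchar (R : nzRingType) p (z : int) :
  p \in [pchar R] -> (z%:~R == 0 :> R) = (p %| `|z|)%N.
Proof.
move=> chR; rewrite (dvdn_pcharf chR); case: (intP z) => [|n|n]; rewrite ?abszN //.
by rewrite mulrNz oppr_eq0.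
Qed.

Section Lift.

Import Pdiv.Ring Pdiv.RingMonic.

Variables (F : finFieldType) (p : nat) (gamma : F).
Hypotheses (chF : p \in [pchar F]).
Let p_pr := pcharf_prime chF.

Let red : {rmorphism {poly int} -> F} := horner_eval gamma \o map_poly intr.

(* [h] is a monic integral lift of the minimal polynomial of [gamma] over the
   prime field. *)
Lemma exists_minpoly_lift : exists h : {poly int},
  [/\ h \is monic, red h = 0 &
    forall P : {poly int}, (size P < size h)%N -> red P = 0 -> exists u, P = u *+ p].
Proof.
(* [Q d]: [gamma ^+ d] is a combination of lower powers over the prime field, seen as the fixed
   points of Frobenius. The least such [d] is the degree of the minimal polynomial. *)
pose Q d := [exists c : {ffun 'I_d -> F}, [forall i, c i ^+ p == c i]
  && (gamma ^+ d == \sum_i c i * gamma ^+ i)].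
have exQ : exists d, Q d.
  (* The relation used is [gamma ^+ #|F| = gamma]. *)
  exists #|F|; have F_gt1 := finRing_gt1 F.
  apply/existsP; exists [ffun i : 'I_#|F| => ((i : nat) == 1%N)%:R].
  apply/andP; split.
    apply/forallP => i; rewrite ffunE -natrX.
    have p_gt0 := prime_gt0 p_pr.
    by case: (_ == 1%N); rewrite ?exp1n ?exp0n.
  rewrite expf_card (bigD1 (Ordinal F_gt1)) //= ffunE /= mul1r expr1.
  rewrite big1 ?addr0 // => i /negPf ni; rewrite ffunE -(inj_eq val_inj) /= in ni *.
  by rewrite ni mul0r.
case: (ex_minnP exQ) => d /existsP[c /andP[/forallP/= c_fix /eqP Dgd]] dmin.
have /fin_all_exists[n Dn] : forall i, exists n : 'I_p, c i = n%:R.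
  by move=> i; apply: frobenius_fixed_natr => //; apply/eqP.
pose h0 : {poly int} := \sum_(i < d) (n i)%:Z%:P * 'X^i.
have sz_h0 : (size h0 <= d)%N.
  apply: leq_trans (size_sum _ _ _) _; apply/bigmax_leqP => i _.
  by rewrite mul_polyC (leq_trans (size_scale_leq _ _)) // size_polyXn.
have sz_h : size ('X^d - h0) = d.+1.
  by rewrite size_polyDl size_polyXn // size_polyN ltnS.
(* The powers below [d] are independent over the prime field: dividing a relation by a last
   coefficient prime to [p] would give [Q e] with [e < d]. *)
have indep e (a : nat -> int) : (e <= d)%N ->
    \sum_(i < e) (a i)%:~R * gamma ^+ i = 0 -> forall i, (i < e)%N -> (p %| `|a i|)%N.
  elim: e => [|e IHe] // lt_ed; rewrite big_ord_recr /=.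
  have [p_ae|p'ae] := boolP (p %| `|a e|)%N.
    move: (p_ae); rewrite -(intr_eq0_pchar _ chF) => /eqP->; rewrite mul0r addr0.
    move=> /(IHe (ltnW lt_ed)) IH i; rewrite ltnS leq_eqVlt => /orP[/eqP->//|].
    exact: IH.
  move=> sum0; suff /dmin : Q e by rewrite leqNgt lt_ed.
  have ae_neq0 : (a e)%:~R != 0 :> F by rewrite (intr_eq0_pchar _ chF).
  apply/existsP; exists [ffun i : 'I_e => - ((a e)%:~R)^-1 * (a i)%:~R].
  apply/andP; split.
    apply/forallP => i; rewrite ffunE -(pFrobenius_autE chF).
    by rewrite rmorphM rmorphN fmorphV !rmorph_int.
  apply/eqP; apply: (mulfI ae_neq0); rewrite mulr_sumr /=.
  move/eqP: sum0; rewrite addrC addr_eq0 => /eqP->; rewrite -sumrN.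
  apply: eq_bigr => i _; rewrite ffunE; field.
  exact: ae_neq0.
exists ('X^d - h0); split.
- by rewrite monicE lead_coefE sz_h /= coefB coefXn eqxx nth_default ?subr0.
- change ((map_poly intr ('X^d - h0)).[gamma] = 0).
  rewrite rmorphB /= map_polyXn rmorph_sum /= hornerD hornerN hornerXn horner_sum Dgd.
  apply/eqP; rewrite subr_eq0; apply/eqP; apply: eq_bigr => i _.
  by rewrite rmorphM /= map_polyC map_polyXn Dn !hornerE.
move=> P; rewrite sz_h ltnS => szP.
change ((map_poly intr P).[gamma] = 0 -> exists u, P = u *+ p).
rewrite (horner_coef_wide _ (leq_trans (size_poly _ _) szP)).
under eq_bigr => i _ do rewrite coef_map /=.
move=> /(indep _ (fun i => P`_i) (leqnn d)) dvdP.
exists (map_poly (fun c => c %/ p)%Z P); apply/polyP => i.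
rewrite coefMn coef_map_id0 ?div0z // -mulr_natr natz.
have [lt_id|le_di] := ltnP i d; first by rewrite divzK // dvdzE /= dvdP.
by rewrite nth_default ?div0z ?mul0r // (leq_trans szP).
Qed.

(** [I k] is the ideal generated by [p ^ k] and the monic lift [h], so that [{poly int}] modulo [h]
    stands in for a ring of p-adic integers. *)
Lemma exists_padic_filtration : exists I, padic_filtration p red I.
Proof.
have [h [h_mon h0 hmin]] := exists_minpoly_lift.
have h_neq0 := monic_neq0 h_mon.
exists (fun k x => exists u v, x = u *+ p ^ k + h * v); split.
- by move=> k _ _ [u [v ->]] [u' [v' ->]];
  exists (u + u'), (v + v'); rewrite mulrnDl mulrDr addrACA.
- move=> a b _ _ [u [v ->]] [u' [v' ->]].
  exists (u * u'), (v * (u' *+ p ^ b) + (u *+ p ^ a) * v' + h * v * v').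
  by rewrite expnD mulrnA -mulrnAr -mulrnAl; ring.
- move=> a b _ le_ab [u [v ->]]; exists (u *+ p ^ (b - a)), v.
  by rewrite -mulrnA -expnD subnK.
- by move=> x; exists x, 0; rewrite mulr0 addr0.
- by move=> k; exists 0, 0; rewrite mul0rn mulr0 addr0.
- by exists 1, 0; rewrite mulr0 addr0.
- move=> x; split=> [x0|[u [v ->]]]; last first.
    by rewrite expn1 rmorphD rmorphM rmorphMn h0 mul0r addr0 -mulr_natr (pcharf0 chF) mulr0.
  (* The remainder modulo [h] also reduces to 0 and is shorter than [h], so [p] divides it. *)
  have [u Du] : exists u, rmodp x h = u *+ p.
    apply: hmin; first by rewrite ltn_rmodpN0.
    move: x0; rewrite {1}(rdivp_eq h_mon x) rmorphD rmorphM.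
    by rewrite h0 mulr0 add0r.
  exists u, (rdivp x h); rewrite {1}(rdivp_eq h_mon x).
  by rewrite expn1 -Du mulrC addrC.
- move=> k n [u [v Dn]].
  (* As [h] has positive degree, the constant [n] is its own remainder modulo [h], and constant
     coefficients can be compared. *)
  have h_gt1 : (1 < size h)%N.
    rewrite ltnNge; apply/negP => sz_h; move: h0.
    have -> : h = 1 by move: (size1_polyC sz_h) (monicP h_mon) => ->; rewrite lead_coefC => ->.
    by rewrite rmorph1 => /eqP; rewrite oner_eq0.
  move/(congr1 (fun P => (rmodp P h)`_0)): Dn; rewrite addrC mulrC.
  rewrite rmodpD // rmodp_mull // add0r.
  rewrite -[u *+ _]scaler_nat rmodpZ // coefZ rmodp_small; last first.
    by rewrite -polyC_natr (leq_ltn_trans (size_polyC_leq1 _)).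
  rewrite -polyC_natr coefC /= => /(congr1 absz).
  by rewrite abszM !natz /= => ->; rewrite dvdn_mulr.
Qed.

End Lift.

(** * Divisibility of the number of nonzero traces *)

Definition field_trace (F : fieldType) (p f : nat) (x : F) : F :=
  \sum_(i < f) x ^+ (p ^ i).

Section TraceCount.

Variables (F : finFieldType) (p f : nat) (gamma : F).
Hypotheses (p_pr : prime p) (f_gt0 : (0 < f)%N) (cardF : #|F| = (p ^ f)%N).
Let M := (p ^ f).-1.
Hypothesis gamma_prim : M.-primitive_root gamma.

Lemma field_trace_fixed (x : F) : field_trace p f x ^+ p = field_trace p f x.
Proof.
have chF := card_finPcharP cardF p_pr.
rewrite -(pFrobenius_autE chF) /field_trace rmorph_sum /=.
have [n Df] : exists n, f = n.+1 by exists f.-1; rewrite prednK.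
rewrite (eq_bigr (fun i : 'I_f => x ^+ (p ^ i.+1))) => [|i _]; last first.
  by rewrite rmorphXn /= pFrobenius_autE -exprM -expnS.
have := expf_card x; rewrite cardF Df => xq.
by rewrite big_ord_recr [RHS]big_ord_recl /= xq expn0 expr1 addrC.
Qed.

Variables (K L r C : nat).
Let N := (L * r)%N.
Hypotheses (KN : (K * N)%N = M) (C_le_f : (C <= f)%N).
Hypothesis digit_sum_ge : forall k, ~~ (r %| k)%N ->
  (C * N <= \sum_(i < f) (k * p ^ i) %% N)%N.

Let pf_gt1 : (1 < p ^ f)%N.
Proof. by rewrite -(exp1n f) ltn_exp2r // prime_gt1. Qed.

Let M_gt0 : (0 < M)%N. Proof. by rewrite /M; lia. Qed.

Let N_gt0 : (0 < N)%N.
Proof. by move: M_gt0; rewrite -KN muln_gt0 => /andP[]. Qed.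

Let co_pN : coprime p N.
Proof.
rewrite -(coprime_pexpl _ _ f_gt0); apply: (coprime_dvdr (n := M)).
  by rewrite -KN dvdn_mull.
by rewrite /M -{1}(prednK (ltnW pf_gt1)) coprimeSn.
Qed.

Section Lifted.

Variables (A : comNzRingType) (red : {rmorphism A -> F}) (I : nat -> A -> Prop).
Hypothesis hI : padic_filtration p red I.
Variable gamma0 : A.
Hypothesis red_gamma0 : red gamma0 = gamma.

Let red_surj x : exists y, red y = x.
Proof.
have [->|x_neq0] := eqVneq x 0; first by exists 0; rewrite rmorph0.
have /(prim_rootP gamma_prim)[i ->] : x ^+ M = 1.
  apply: (mulIf x_neq0).
  by rewrite mul1r -exprSr prednK ?(ltnW pf_gt1) // -cardF expf_card.
by exists (gamma0 ^+ i); rewrite rmorphXn /= red_gamma0.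
Qed.

(* The Teichmueller lift of [gamma], up to [I C]. *)
Let g := gamma0 ^+ (p ^ (f * C)).

Let red_g : red g = gamma.
Proof.
rewrite /g rmorphXn /= red_gamma0; elim: C => [|n IHn]; first by rewrite muln0.
by rewrite mulnS expnD exprM -cardF expf_card.
Qed.

(** [gamma0 ^+ M] is 1 modulo [I 1], and each [p]-th power improves the congruence by one step. The
    factor [f] in the exponent of [g] keeps [red g = gamma]. *)
Let g_order : I C (g ^+ M - 1).
Proof.
rewrite /g exprAC -[X in _ - X](expr1n _ (p ^ (f * C))).
apply: (filt_le hI (b := (f * C).+1)); first by rewrite ltnW // ltnS leq_pmull.
apply: filt_expB_pexpn p_pr hI _ _ _ _; apply/(filt_red hI).
by rewrite rmorphB rmorphXn rmorph1 /= red_gamma0 prim_expr_order ?subrr.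
Qed.

Let g_pow e : (M %| e)%N -> I C (g ^+ e - 1).
Proof.
case/dvdnP=> k ->; rewrite mulnC exprM subrX1.
by apply: (filtMr hI).
Qed.

Let red_g_pow e : (red (g ^+ e) == 1) = (M %| e)%N.
Proof. by rewrite rmorphXn /= red_g (prim_order_dvd gamma_prim). Qed.

(** The double sum is a product of geometric sums with ratios [g ^+ e] and [g ^+ (N * e)]. Either
    [filt_geom] puts one of them in [I C], or the weight of [e] is at least [C * M], which forces
    [C.-1 <= v], so that [c] alone suffices. *)
Lemma filt_class_power_sum e v c : (0 < e)%N -> I v c ->
  (weight p f e <= v.+1 * M)%N ->
  I C.-1 (c * \sum_(i < L) \sum_(j < K) (g ^+ (i + j * N)) ^+ e).
Proof.
move=> e_gt0 Ic le_e.
have -> : \sum_(i < L) \sum_(j < K) (g ^+ (i + j * N)) ^+ e =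
    (\sum_(i < L) (g ^+ e) ^+ i) * (\sum_(j < K) (g ^+ (N * e)) ^+ j).
  rewrite mulr_suml; apply: eq_bigr => i _; rewrite mulr_sumr.
  by apply: eq_bigr => j _; rewrite -!exprM -exprD; congr (_ ^+ _); ring.
have small x : I C x -> I C.-1 (c * x).
  by move=> Ix; apply/(filtMl hI)/(filt_le hI (leq_pred C)).
have big : (C * M <= weight p f e)%N -> forall x, I C.-1 (c * x).
  move=> ge_e x; apply: (filtMr hI); apply: (filt_le hI (b := v)) => //.
  have := leq_trans ge_e le_e; rewrite leq_pmul2r // => le_Cv.
  by lia.
have [dvd_Ne|ndvd_Ne] := boolP (M %| N * e)%N; last first.
  apply/small/(filtMl hI)/(filt_geom hI red_surj); first by rewrite red_g_pow.
  by rewrite -exprM; apply: g_pow; rewrite -KN mulnAC dvdn_mulr // mulnC.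
have [k De] : exists k, e = (K * k)%N.
  have /dvdnP[k ->] : (K %| e)%N by move: dvd_Ne; rewrite -KN mulnC dvdn_pmul2l.
  by exists k; rewrite mulnC.
have [r_dvd|r_ndvd] := boolP (r %| k)%N; last first.
  apply: big; rewrite De (weight_mul _ _ KN) ?prime_gt1 //; last first.
    by apply: contra r_ndvd; apply: dvdn_trans; rewrite dvdn_mull.
  by rewrite -KN mulnCA leq_mul2l digit_sum_ge ?orbT.
(* Now [r] divides [k], so [M] divides [L * e]: the sum over [i] is in [I C] unless [M] divides [e],
   and then the weight is [f * M]. *)
have [N_dvd|N_ndvd] := boolP (N %| k)%N.
  have M_dvd : (M %| e)%N by rewrite De -KN dvdn_mul.
  by apply: big; rewrite weight_dvd ?prime_gt1 // leq_mul2r C_le_f orbT.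
apply/small/(filtMr hI)/(filt_geom hI red_surj).
  rewrite red_g_pow De -KN dvdn_pmul2l //.
  by move: M_gt0; rewrite -KN muln_gt0 => /andP[].
by rewrite -exprM; apply: g_pow; rewrite De -KN -mulnA dvdn_mul // mulnC dvdn_mul.
Qed.

Lemma filt_class_sum P : weight_le p I f p.-1 P ->
  I C.-1 (\sum_(i < L) \sum_(j < K) P.[g ^+ (i + j * N)]).
Proof.
elim=> [|Q v c e e_gt0 Ic le_e _ IH].
  rewrite big1 => [|i _]; first exact: filt0 hI _.
  rewrite big1 // => j _.
  by rewrite horner0.
under eq_bigr => i _ do under eq_bigr => j _ do rewrite hornerD hornerCM hornerXn.
under eq_bigr => i _ do rewrite big_split -mulr_sumr.
rewrite big_split -mulr_sumr; apply: filtD hI _ _ _ _ IH.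
apply: (filt_class_power_sum e_gt0 Ic).
have p1_gt0 : (0 < p.-1)%N by have := prime_gt1 p_pr; lia.
by rewrite -(leq_pmul2r p1_gt0) [leqRHS]mulnAC mulSn.
Qed.

Lemma filt_class_trace b : I C.-1
  (\sum_(i < L) \sum_(j < K)
     (field_trace p f (gamma ^+ (b + (i + j * N))) != 0)%R)%N%:R.
Proof.
(* The value of [T] at [g ^+ a] lifts the trace of [gamma ^+ (b + a)]. The power [p.-1] turns it
   into the 0-1 indicator of a nonzero trace modulo [I 1]; the power [p ^ C] refines this to
   [I C.+1] at no cost in weight. *)
pose T : {poly A} := \sum_(i < f) (g ^+ (b * p ^ i))%:P * 'X^(p ^ i).
pose P := (T ^+ (p ^ C)) ^+ p.-1.
have p_gt0 := prime_gt0 p_pr; have p_gt1 := prime_gt1 p_pr.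
have WT : weight_le p I f 1 T.
  apply: weight_le_sum => i _; apply: (weight_le_mono (v := 0)).
  - by rewrite expn_gt0 p_gt0.
  - exact: filtT hI _.
  - by rewrite weight_expp // mul1n.
have WP : weight_le p I f p.-1 P.
  by rewrite -[p.-1]mul1n; apply: (weight_leX p_pr hI);
    [lia|apply: (weight_le1_pexpn p_pr hI f_gt0)].
have := filt_class_sum WP.
set S := \sum_(i < L) _ => IS.
suff Idiff : I C.-1 (S - (\sum_(i < L) \sum_(j < K)
     (field_trace p f (gamma ^+ (b + (i + j * N))) != 0)%R)%N%:R).
  by have := filtB hI IS Idiff; rewrite subKr.
rewrite natr_sum -sumrB; apply: (filt_sum hI) => i _.
rewrite natr_sum -sumrB; apply: (filt_sum hI) => j _.
apply: (filt_le hI (b := C.+1)); first by rewrite ltnW // ltnS leq_pred.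
set a := (i + j * N)%N; set y := field_trace _ _ _.
have red_T : red T.[g ^+ a] = y.
  rewrite horner_sum rmorph_sum; apply: eq_bigr => k _ /=.
  rewrite hornerCM hornerXn -[(g ^+ a) ^+ _]exprM -exprD -mulnDl rmorphXn /= red_g.
  by rewrite exprM.
rewrite /P !horner_exp exprAC.
have -> : (y != 0)%:R = (y != 0)%:R ^+ (p ^ C) :> A.
  by case: (y != 0); rewrite ?expr1n // expr0n eqn0Ngt expn_gt0 p_gt0.
apply: filt_expB_pexpn p_pr hI _ _ _ _; apply/(filt_red hI).
rewrite rmorphB rmorphXn rmorph_nat red_T.
have [->|y_neq0] := eqVneq y 0; first by rewrite expr0n subr0; case: eqP => //; lia.
apply/eqP; rewrite subr_eq0; apply/eqP/(mulIf y_neq0).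
by rewrite mul1r -exprSr prednK // field_trace_fixed.
Qed.

End Lifted.

Lemma dvdn_class_trace b : (p ^ C.-1 %|
  \sum_(i < L) \sum_(j < K)
     (field_trace p f (gamma ^+ (b + (i + j * N))) != 0)%R)%N.
Proof.
have chF := card_finPcharP cardF p_pr.
have [I hI] := exists_padic_filtration gamma chF.
(* The reduction evaluates at [gamma], so ['X] is a lift of [gamma]. *)
apply: (filt_nat hI); apply: (@filt_class_trace _ _ _ hI 'X).
by rewrite /= map_polyX /horner_eval hornerX.
Qed.

End TraceCount.

(** * Fourier analysis on [F] and strong regularity *)

Section Fourier.

Variables (F : finFieldType) (psi : F -> algC).
Hypothesis psiD : forall x y, psi (x + y) = psi x * psi y.
Hypothesis additive_char0 : psi 0 = 1.
Hypothesis psi_nontriv : exists x, psi x != 1.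

Lemma sum_additive_char y : \sum_x psi (x * y) = #|F|%:R * (y == 0)%:R.
Proof.
have [->|y_neq0] := eqVneq y 0.
  by rewrite mulr1 (eq_bigr (fun _ => 1)) ?sumr_const // => x _; rewrite mulr0 additive_char0.
rewrite mulr0; have [t psi_t] := psi_nontriv.
set S := \sum_x _; have : psi t * S = S.
  rewrite [RHS](reindex_inj (addrI (t / y))) mulr_sumr; apply: eq_bigr => x _.
  by rewrite mulrDl divfK // psiD.
move/eqP; rewrite -subr_eq0 -{2}[S]mul1r -mulrBl mulf_eq0 subr_eq0 (negPf psi_t).
by move/eqP.
Qed.

Variable D : {set F}.
Hypothesis D_sym : forall x, (- x \in D) = (x \in D).

Definition char_sum (x : F) : algC := \sum_(d in D) psi (x * d).

Lemma char_sum0 : char_sum 0 = #|D|%:R.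
Proof.
rewrite /char_sum (eq_bigr (fun _ => 1)) ?sumr_const // => d _.
by rewrite mul0r additive_char0.
Qed.

Lemma char_sum_inversion z :
  \sum_x char_sum x * psi (x * - z) = #|F|%:R * (z \in D)%:R.
Proof.
transitivity (\sum_(d in D) \sum_x psi (x * (d - z))).
  rewrite exchange_big /=; apply: eq_bigr => x _; rewrite mulr_suml.
  by apply: eq_bigr => d _; rewrite -psiD mulrDr.
under eq_bigr => d _ do rewrite sum_additive_char subr_eq0.
rewrite -mulr_sumr; congr (_ * _).
have [zD|zD] := boolP (z \in D).
  by rewrite (bigD1 z) //= eqxx big1 ?addr0 // => d /andP[_ /negPf->].
by rewrite big1 // => d dD; case: eqP => // Ddz; rewrite -Ddz dD in zD.
Qed.

Lemma char_sum_sq_inversion z :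
  \sum_x char_sum x ^+ 2 * psi (x * - z) =
  #|F|%:R * #|[set a in D | a - z \in D]|%:R.
Proof.
transitivity (\sum_(d in D) \sum_x char_sum x * psi (x * - (z - d))).
  rewrite exchange_big /=; apply: eq_bigr => x _.
  rewrite expr2 -mulrA [X in _ * X]mulr_suml mulr_sumr; apply: eq_bigr => d _.
  by rewrite -psiD -mulrDr opprB.
under eq_bigr => d _ do rewrite char_sum_inversion -D_sym opprB.
rewrite -mulr_sumr; congr (_ * _).
rewrite -sum1_card natr_sum [RHS](eq_bigl (fun d => (d \in D) && (d - z \in D))).
  by rewrite [RHS]big_mkcondr; apply: eq_bigr => d _; case: ifP.
by move=> d; rewrite inE.
Qed.

Hypothesis D0 : 0 \notin D.

Lemma sum_char_sum : \sum_x char_sum x = 0.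
Proof.
have := char_sum_inversion 0; rewrite (negPf D0) mulr0 => E; rewrite -[RHS]E.
by apply: eq_bigr => x _; rewrite oppr0 mulr0 additive_char0 mulr1.
Qed.

Lemma sum_char_sum_sq : \sum_x char_sum x ^+ 2 = #|F|%:R * #|D|%:R.
Proof.
have := char_sum_sq_inversion 0.
have -> : [set a in D | a - 0 \in D] = D.
  by apply/setP => a; rewrite inE subr0 andbb.
by move=> E; rewrite -[RHS]E; apply: eq_bigr => x _; rewrite oppr0 mulr0 additive_char0 mulr1.
Qed.

(** The product of the two factors is supported at 0, so its Fourier transform is constant. Hence
    for [z != 0] the number [n z] of ways to write [z] as a difference in [D] depends only on
    whether [z] lies in [D]; [d] and [c] represent the two cases. *)
Lemma two_char_sums_srg (r s : algC) (d c : F) :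
  d \in D -> c != 0 -> c \notin D ->
  (forall x, x != 0 -> (char_sum x - r) * (char_sum x - s) = 0) ->
  strongly_regular (Cay D).
Proof.
move=> dD c_neq0 cD two_values.
pose n z := #|[set a in D | a - z \in D]|.
have n_eq z : z != 0 -> #|F|%:R * (n z)%:R =
    (r + s) * (#|F|%:R * (z \in D)%:R) + (#|D|%:R - r) * (#|D|%:R - s) :> algC.
  move=> z_neq0; rewrite -char_sum_sq_inversion -char_sum_inversion.
  have sum0 : \sum_x psi (x * - z) = 0.
    by rewrite sum_additive_char oppr_eq0 (negPf z_neq0) mulr0.
  have <- : \sum_x (char_sum x - r) * (char_sum x - s) * psi (x * - z) =
      (#|D|%:R - r) * (#|D|%:R - s).
    rewrite (bigD1 0) //= char_sum0 mul0r additive_char0 mulr1 big1 ?addr0 //.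
    by move=> x /two_values ->; rewrite mul0r.
  rewrite [X in _ = _ + X](eq_bigr (fun x => char_sum x ^+ 2 * psi (x * - z) -
     (r + s) * (char_sum x * psi (x * - z)) + r * s * psi (x * - z))).
    by rewrite big_split sumrB /= -!mulr_sumr sum0; ring.
  by move=> x _; ring.
have q_neq0 : #|F|%:R != 0 :> algC.
  by rewrite Num.Theory.pnatr_eq0 -lt0n ltnW // finRing_gt1.
have n_const y z : y != 0 -> z != 0 -> (y \in D) = (z \in D) -> n y = n z.
  move=> y_neq0 z_neq0 Eyz; apply/eqP; rewrite -(Num.Theory.eqr_nat algC).
  by apply/eqP/(mulfI q_neq0); rewrite !n_eq // Eyz.
have sub_inj (x : F) : injective (fun a => x - a).
  by apply: inj_comp oppr_inj; apply: addrI.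
(* A common neighbor [a] corresponds to [x - a] in [D], as [y - a] is [(x - a) - (x - y)]. *)
have nbhd_n x y : #|nbhd (Cay D) x :&: nbhd (Cay D) y| = n (x - y).
  rewrite /n -[RHS](card_imset _ (sub_inj x)); apply: eq_card => a.
  rewrite in_setI; apply/andP/imsetP => [[]|[b]]; rewrite !inE /Cay.
    move=> xaD yaD.
    exists (x - a); last by rewrite subKr.
    by rewrite inE xaD (_ : x - a - (x - y) = y - a) //; ring.
  case/andP=> [bD bxyD] ->; rewrite subKr; split=> //.
  by rewrite (_ : y - (x - b) = b - (x - y)) //; ring.
have neq0D x : x \in D -> x != 0 by apply: contraTneq => ->.
exists #|F|, #|D|, (n d), (n c); split=> //.
- by move=> x y; rewrite /Cay -D_sym opprB.
- by move=> x; rewrite /Cay subrr (negPf D0).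
- move=> x; rewrite -(card_imset D (sub_inj x)).
  apply: eq_card => y; rewrite inE /Cay; apply/idP/imsetP => [xyD|[a aD ->]] /=.
    by exists (x - y); rewrite //= subKr.
  by rewrite subKr.
- by exists c, 0; rewrite /Cay subr0.
- by exists d, 0; rewrite /Cay subr0.
- by move=> x y xyD; rewrite nbhd_n; apply: n_const; rewrite ?neq0D ?dD.
- move=> x y xy xyD; rewrite nbhd_n; apply: n_const; rewrite ?subr_eq0 //.
  by rewrite (negPf cD); apply/negbTE.
Qed.

End Fourier.

(** * The trace character and integrality of its sums *)

Section TraceCharacter.

Variables (F : finFieldType) (p f : nat).
Hypotheses (p_pr : prime p) (f_gt0 : (0 < f)%N) (cardF : #|F| = (p ^ f)%N).

Let chF : p \in [pchar F] := card_finPcharP cardF p_pr.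

Lemma field_traceD (x y : F) :
  field_trace p f (x + y) = field_trace p f x + field_trace p f y.
Proof.
rewrite /field_trace -big_split; apply: eq_bigr => i _.
by rewrite exprDn_pchar // pnatX pnatE // chF.
Qed.

(** The trace is a polynomial map of degree [p ^ f.-1], which is less than [#|F|]. *)
Lemma exists_field_trace_neq0 : exists x : F, field_trace p f x != 0.
Proof.
apply/existsP; apply: contraT => /existsPn/= tr0.
have p_gt1 := prime_gt1 p_pr.
have [n Df] : exists n, f = n.+1 by exists f.-1; rewrite prednK.
pose P : {poly F} := \sum_(i < f) 'X^(p ^ i).
have sz_P : size P = (p ^ n).+1.
  rewrite /P Df big_ord_recr /= addrC size_polyDl size_polyXn // ltnS.
  apply: leq_trans (size_sum _ _ _) _; apply/bigmax_leqP => i _.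
  by rewrite size_polyXn ltn_exp2l.
have P_neq0 : P != 0 by rewrite -size_poly_eq0 sz_P.
have /(max_poly_roots P_neq0) : all (root P) (enum F).
  apply/allP => x _; rewrite /root horner_sum; move: (tr0 x); rewrite negbK.
  by under eq_bigr => i _ do rewrite hornerXn.
move=> /(_ (enum_uniq _)); rewrite sz_P -cardE cardF Df ltnS leq_exp2l //.
by rewrite ltnn.
Qed.

Lemma natr_pchar_eq a b : (a%:R == b%:R :> F) = (a == b %[mod p])%N.
Proof.
wlog le_ba : a b / (b <= a)%N => [IH|].
  by case/orP: (leq_total a b) => /IH // E; rewrite eq_sym E eq_sym.
by rewrite -subr_eq0 -natrB // -(dvdn_pcharf chF) eqn_mod_dvd.
Qed.

Lemma exists_trace_character : exists psi : F -> algC,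
  [/\ forall x y, psi (x + y) = psi x * psi y,
      forall x, (psi x == 1) = (field_trace p f x == 0)
    & forall x, psi x \in Aint].
Proof.
have [z z_prim] := C_prim_root_exists (prime_gt0 p_pr).
have /fin_all_exists[n Dn] : forall x : F, exists n : 'I_p, field_trace p f x = n%:R.
  by move=> x; apply: frobenius_fixed_natr chF _; apply: field_trace_fixed.
exists (fun x => z ^+ n x); split=> [x y|x|x].
- rewrite -exprD; apply/eqP; rewrite (eq_prim_root_expr z_prim) -natr_pchar_eq.
  by rewrite natrD -!Dn field_traceD.
- by rewrite -(expr0 z) (eq_prim_root_expr z_prim) -natr_pchar_eq Dn.
- by apply: rpredX; apply: (Aint_unity_root (prime_gt0 p_pr)); apply/unity_rootP/prim_expr_order.
Qed.

Variable psi : F -> algC.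
Hypothesis psiD : forall x y, psi (x + y) = psi x * psi y.
Hypothesis psi_eq1 : forall x, (psi x == 1) = (field_trace p f x == 0).
Hypothesis psi_Aint : forall x, psi x \in Aint.

Lemma trace_character0 : psi 0 = 1.
Proof.
apply/eqP; rewrite psi_eq1 /field_trace big1 // => i _.
by rewrite expr0n eqn0Ngt expn_gt0 prime_gt0.
Qed.

Lemma trace_characterMn x n : psi (x *+ n) = psi x ^+ n.
Proof.
elim: n => [|n IHn]; first by rewrite mulr0n trace_character0.
by rewrite mulrS psiD IHn exprS.
Qed.

Lemma sum_trace_characterMn x :
  \sum_(n < p) psi (x *+ n) = (p * (field_trace p f x == 0))%:R.
Proof.
under eq_bigr => n _ do rewrite trace_characterMn.
rewrite -psi_eq1; have [->|psi_neq1] := eqVneq.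
  by rewrite muln1 (eq_bigr (fun _ => 1)) ?sumr_const ?card_ord // => n _; rewrite expr1n.
rewrite muln0; apply/eqP; move: (subrX1 (psi x) p).
rewrite -trace_characterMn -[x *+ p]mulr_natr (pcharf0 chF) mulr0 trace_character0 subrr.
by move/esym/eqP; rewrite mulf_eq0 subr_eq0 (negPf psi_neq1).
Qed.

Variable D : {set F}.
Hypothesis D_mul : forall n x, (0 < n < p)%N -> (x *+ n \in D) = (x \in D).

Definition trace_count (x : F) : nat :=
  (\sum_(d in D) (field_trace p f (x * d) != 0)%R)%N.

(** The sum of [char_sum psi D (x *+ n)] over [n < p] is computed twice: stability of [D] makes all
    terms with [n != 0] equal, while summing over [n] first gives [p] for each [d] with trace 0. *)
Lemma char_sum_trace_count x :
  (#|D|%:R - char_sum psi D x) * (p.-1)%:R = (p * trace_count x)%:R.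
Proof.
have p_gt0 := prime_gt0 p_pr.
have sumD k : (k < p)%N -> \sum_(n < k.+1) char_sum psi D (x *+ n) =
    #|D|%:R + char_sum psi D x * k%:R.
  elim: k => [|k IHk] lt_kp.
    by rewrite big_ord1 mulr0n (char_sum0 trace_character0) mulr0 addr0.
  rewrite big_ord_recr /= IHk ?(ltnW lt_kp) // -addrA -[in RHS]addn1 natrD mulrDr mulr1.
  congr (_ + (_ + _)).
  have n_unit : (k.+1)%:R != 0 :> F.
    rewrite -(dvdn_pcharf chF); apply/negP => /(dvdn_leq (ltn0Sn k)).
    by rewrite leqNgt lt_kp.
  rewrite /char_sum [RHS](reindex_inj (mulIf n_unit)) /=.
  apply: eq_big => d; first by rewrite mulr_natr D_mul.
  by move=> _; rewrite mulr_natr mulrnAr mulrnAl.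
have {}sumD := sumD p.-1; rewrite prednK // in sumD.
have : \sum_(n < p) char_sum psi D (x *+ n) = (p * (#|D| - trace_count x))%:R.
  rewrite exchange_big /= (_ : #|D| - _ = \sum_(d in D) (field_trace p f (x * d) == 0)%R)%N.
    rewrite big_distrr natr_sum; apply: eq_bigr => d _.
    by rewrite -sum_trace_characterMn; apply: eq_bigr => n _; rewrite mulrnAl.
  rewrite -sum1_card (eq_bigr (fun d => (field_trace p f (x * d) == 0)%R +
     (field_trace p f (x * d) != 0)%R))%N; last by move=> d _; case: eqP.
  by rewrite big_split addnK.
rewrite sumD // mulnBr natrB; last first.
  rewrite leq_mul2l -sum1_card leq_sum ?orbT // => d _.
  by case: eqP.
move=> E; have -> : (p * trace_count x)%:R =
  (p * #|D|)%:R - (#|D|%:R + char_sum psi D x * (p.-1)%:R) :> algC.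
  by rewrite E subKr.
by rewrite -{2}(prednK p_gt0) mulSn natrD natrM; ring.
Qed.

(** With [u] the trace count, [p * u / p.-1] is a rational algebraic integer, so [p.-1] divides [u].
    It is coprime to [p], and [v] is [u] divided by [p.-1 * p ^ C.-1]. *)
Lemma char_sum_dvd C x : (0 < C)%N -> (p ^ C.-1 %| trace_count x)%N ->
  exists v : nat, char_sum psi D x = #|D|%:R - (p ^ C * v)%:R.
Proof.
move=> C_gt0 dvd_u; have p_gt1 := prime_gt1 p_pr.
have p1_neq0 : (p.-1)%:R != 0 :> algC.
  by rewrite Num.Theory.pnatr_eq0; lia.
have E := char_sum_trace_count x.
have Dt : #|D|%:R - char_sum psi D x = (p * trace_count x)%:R / (p.-1)%:R.
  by rewrite -E mulfK.
have /Num.Theory.intrP[t Et] : #|D|%:R - char_sum psi D x \in Num.int.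
  apply: Cint_rat_Aint; first by rewrite Dt rpred_div ?rpred_nat.
  by rewrite rpredB ?rpred_nat // rpred_sum.
have p1_dvd : (p.-1 %| trace_count x)%N.
  have : (p.-1 %| p * trace_count x)%N.
    suff : (Posz p.-1 %| Posz (p * trace_count x))%Z by [].
    apply/dvdzP; exists t; apply/eqP; rewrite -(eqr_int algC).
    by rewrite intrM -!pmulrn -E Et.
  by rewrite Gauss_dvdr // -{2}(prednK (ltnW p_gt1)) coprimenS.
have /dvdnP[v Dv] : (p.-1 * p ^ C.-1 %| trace_count x)%N.
  rewrite Gauss_dvd ?p1_dvd // coprimeXr //.
  by rewrite -{2}(prednK (ltnW p_gt1)) coprimenS.
exists v; suff <- : #|D|%:R - char_sum psi D x = (p ^ C * v)%:R by rewrite subKr.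
rewrite Dt Dv -(prednK C_gt0) expnS /= !natrM.
by field.
Qed.

End TraceCharacter.

(** * Powers of 11 modulo powers of 43 *)

Section Arithmetic.

Local Open Scope nat_scope.

Lemma expn_add1_bin x n :
  exists B, (1 + x) ^ n = 1 + n * x + 'C(n, 2) * x ^ 2 + x ^ 3 * B.
Proof.
elim: n => [|n [B IHn]]; first by exists 0; rewrite bin0n; lia.
exists ('C(n, 2) + B * (1 + x)); rewrite expnSr IHn binS bin1.
ring.
Qed.

Lemma modn_exp_iter a n d : a ^ n = iter n (fun x => (a * x) %% d) 1 %[mod d].
Proof. by elim: n => [|n IHn] //=; rewrite modn_mod expnS -modnMmr IHn modnMmr. Qed.

(** The 43rd power of [1 + 43 ^ k.+1 * u] gains exactly one factor 43: the terms after the linear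
    one are divisible by [43 ^ k.+3], the quadratic one because 43 divides ['C(43, 2)]. *)
Lemma expn11_lift k : exists2 u, ~~ (43 %| u) & 11 ^ (7 * 43 ^ k) = 1 + 43 ^ k.+1 * u.
Proof.
elim: k => [|k [u u_ndvd IHk]].
  (* The base case is [11 ^ 7 = 560] modulo [43 ^ 2], where [560 = 1 + 43 * 13]. *)
  have mod_ex z : z = 560 %[mod 43 ^ 2] -> exists a, z = 560 + 1849 * a.
    by move=> Ez; exists (z %/ 43 ^ 2); rewrite {1}(divn_eq z (43 ^ 2)) Ez addnC mulnC.
  have [|a ->] := mod_ex (11 ^ 7); first by rewrite modn_exp_iter; vm_compute.
  exists (13 + 43 * a); first by rewrite dvdn_addl ?dvdn_mulr.
  by rewrite expn1; lia.
rewrite expnSr mulnA expnM IHk.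
have [B ->] := expn_add1_bin (43 ^ k.+1 * u) 43.
pose v := 21 * 43 ^ k * u ^ 2 + 43 ^ (2 * k) * u ^ 3 * B.
exists (u + 43 * v); first by rewrite dvdn_addl ?dvdn_mulr.
rewrite (_ : 'C(43, 2) = 43 * 21) ?bin2 // /v.
rewrite !expnS mulnC [2 * k]mulnC expnM /=; ring.
Qed.

Lemma expn11_mod7 j : 11 ^ j = 11 ^ (j %% 7) %[mod 43].
Proof.
have E7 : 11 ^ 7 = 1 %[mod 43] by rewrite modn_exp_iter; vm_compute.
rewrite {1}(divn_eq j 7) expnD mulnC [(j %/ 7) * 7]mulnC expnM -modnMmr -modnXm.
by rewrite E7 modnXm exp1n modnMmr muln1.
Qed.

(** In the induction step [e = a * (7 * 43 ^ m)], and modulo [43 ^ m.+2] the power is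
    [1 + a * 43 ^ m.+1 * u] with [u] prime to 43, so 43 divides [a]. *)
Lemma expn11_order m e :
  11 ^ e = 1 %[mod 43 ^ m.+1] -> 7 * 43 ^ m %| e.
Proof.
elim: m => [|m IHm] He.
  rewrite muln1 /dvdn; move: He; rewrite expn1 expn11_mod7 modn_exp_iter.
  have /allP : all (fun r => (iter r (fun x => (11 * x) %% 43) 1 == 1 %[mod 43])
      ==> (r == 0)) (iota 0 7) by vm_compute.
  move=> /(_ (e %% 7)); rewrite mem_iota ltn_mod => /(_ isT)/implyP + E.
  by apply; apply/eqP.
have /dvdnP[a De] : 7 * 43 ^ m %| e.
  by apply: IHm; rewrite -(modn_dvdm _ (dvdn_exp2l 43 (leqnSn m.+1))) He modn_dvdm // dvdn_exp2l.
rewrite De expnS mulnCA dvdn_pmul2r ?muln_gt0 ?expn_gt0 //.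
have [u u_ndvd Eu] := expn11_lift m.
have [B] := expn_add1_bin (43 ^ m.+1 * u) a.
rewrite -Eu -expnM mulnC -De => E; move: He; rewrite E.
move/eqP; rewrite -!addnA eqn_mod_dvd ?leq_addr // addKn.
rewrite dvdn_addl.
  by rewrite mulnCA expnSr dvdn_pmul2l ?expn_gt0 // Euclid_dvdM // (negPf u_ndvd) orbF.
have dvd2 : 43 ^ m.+2 %| (43 ^ m.+1) ^ 2 by rewrite -expnM dvdn_exp2l //; lia.
have dvd_x2 : 43 ^ m.+2 %| (43 ^ m.+1 * u) ^ 2 by rewrite expnMn dvdn_mulr.
by rewrite dvdn_add ?(dvdn_mull _ dvd_x2) // [_ ^ 3]expnSr -mulnA dvdn_mulr.
Qed.

Lemma expn11_eq1 m : 11 ^ (7 * 43 ^ m) = 1 %[mod 43 ^ m.+1].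
Proof. by have [u _ ->] := expn11_lift m; rewrite addnC mulnC modnMDl. Qed.

(** The bound is [3 * 43], checked by computation on the 42 nonzero residues. *)
Lemma digit_sum11_base k : ~~ (43 %| k) ->
  129 <= \sum_(j < 7) (k * 11 ^ j) %% 43.
Proof.
move=> k_ndvd; pose r := k %% 43.
have : r \in iota 1 42 by rewrite mem_iota lt0n k_ndvd ltn_mod.
have Er (j : nat) : (k * 11 ^ j) %% 43 = (r * iter j (fun x => (11 * x) %% 43) 1) %% 43.
  by rewrite -modnMml -/r -modnMmr modn_exp_iter modnMmr.
rewrite !big_ord_recr big_ord0 /= !Er /=.
move: r {Er}; apply/allP; by vm_compute.
Qed.

(** The order of 11 makes the orbit [s1] of [k] free of repetitions. It lies in [s2], which lists
    all residues above the orbit of [k] modulo 43 and is no longer than [s1], so the two agree up to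
    order. *)
Lemma digit_sum11 m c k : 2 * c + 1 = 7 * 43 ^ m -> ~~ (43 %| k) ->
  c * (43 ^ m * 43) <= \sum_(i < 7 * 43 ^ m) (k * 11 ^ i) %% (43 ^ m * 43).
Proof.
set L := 43 ^ m => Dc k_ndvd; have L_gt0 : 0 < L by rewrite expn_gt0.
pose s1 := [seq (k * 11 ^ i) %% (L * 43) | i <- iota 0 (7 * L)].
pose s2 := [seq 43 * y + (k * 11 ^ j) %% 43 | y <- iota 0 L, j <- iota 0 7].
have co_k : coprime (L * 43) k.
  by rewrite -expnSr coprimeXl // prime_coprime.
have co_11 i : coprime (L * 43) (11 ^ i).
  by rewrite -expnSr coprimeXl // coprimeXr.
have s1_uniq : uniq s1.
  rewrite map_inj_in_uniq ?iota_uniq // => i j.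
  rewrite !mem_iota /= !add0n => lt_i lt_j Eij.
  wlog le_ij : i j lt_i lt_j Eij / i <= j => [IH|].
    by case/orP: (leq_total i j) => ?; [apply: IH|apply/esym/IH].
  move/eqP: Eij; rewrite eq_sym eqn_mod_dvd ?leq_mul2l ?leq_exp2l ?le_ij ?orbT //.
  rewrite -mulnBr Gauss_dvdr // -{1}(subnK le_ij) expnD -{2}[11 ^ i]mul1n -mulnBl.
  rewrite Gauss_dvdl // -eqn_mod_dvd ?expn_gt0 // -expnSr => /eqP/expn11_order dvd.
  by case: (posnP (j - i)) => [|/dvdn_leq/(_ dvd)]; rewrite -/L; lia.
have s1_sub : {subset s1 <= s2}.
  move=> _ /mapP[i _ ->]; apply/allpairsP.
  exists (pair ((k * 11 ^ i) %% (L * 43) %/ 43) (i %% 7)); split; rewrite ?mem_iota /=.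
  - by rewrite ltn_divLR // ltn_mod muln_gt0 L_gt0.
  - by rewrite ltn_mod.
  rewrite {1}(divn_eq ((k * 11 ^ i) %% (L * 43)) 43) mulnC; congr (_ + _).
  by rewrite modn_dvdm ?dvdn_mull // -modnMmr expn11_mod7 modnMmr.
have sz : size s2 <= size s1.
  by rewrite size_allpairs size_map !size_iota mulnC.
have [_ s12] := uniq_min_size s1_uniq s1_sub sz.
have s2_uniq := leq_size_uniq s1_uniq s1_sub sz.
have E : \sum_(i < 7 * L) (k * 11 ^ i) %% (L * 43) = \sum_(x <- s2) x.
  rewrite -(perm_big _ (uniq_perm s1_uniq s2_uniq s12)) big_map.
  by rewrite -(big_mkord xpredT (fun i => (k * 11 ^ i) %% (L * 43))) /index_iota subn0.
have le_y (y : nat) : 301 * y + 129 <= \sum_(j <- iota 0 7) (43 * y + (k * 11 ^ j) %% 43).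
  rewrite big_split -[iota 0 7]/(index_iota 0 7) sum_nat_const_nat leq_add //.
    by lia.
  by rewrite big_mkord digit_sum11_base.
rewrite E big_allpairs_dep.
have -> : iota 0 L = index_iota 0 L by rewrite /index_iota subn0.
(* The sum of [301 * y + 129] over [y < L] equals [43 * c * L] exactly. *)
rewrite big_mkord; apply: (@leq_trans (\sum_(y < L) (301 * y + 129))); last first.
  by apply: leq_sum => y _; apply: le_y.
have sum_id n : 2 * \sum_(y < n) y + n = n * n.
  elim: n => [|n IHn]; rewrite ?big_ord0 // big_ord_recr /=.
  by move: IHn; move: (\sum_(y < n) y) => S; lia.
rewrite big_split -big_distrr sum_nat_const card_ord /=; have := sum_id L.
by move: (\sum_(y < L) y) Dc => S Dc SL; nia.
Qed.

End Arithmetic.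

(** * Primitive roots and unions of cyclotomic classes *)

Lemma generator_prim_root (F : finFieldType) (gamma : {unit F}) :
  generator [set: {unit F}] gamma -> #|F|.-1.-primitive_root (val gamma).
Proof.
move=> /eqP gen; have M_gt0 : (0 < #|F|.-1)%N by rewrite -subn1 subn_gt0 finRing_gt1.
have ord_g : #[gamma]%g = #|F|.-1 by rewrite orderE -gen card_finField_unit.
have gM : val gamma ^+ #|F|.-1 = 1.
  by rewrite -FinRing.val_unitX -ord_g expg_order.
have [n n_prim dvd_n] := prim_order_exists M_gt0 gM.
suff -> : #|F|.-1 = n by [].
apply/eqP; rewrite eqn_dvd dvd_n andbT -ord_g order_dvdn.
by rewrite -val_eqE /= FinRing.val_unitX (prim_expr_order n_prim).
Qed.

Section CyclotomicUnion.

Variables (F : finFieldType) (gamma : F) (L r : nat).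
Let N := (L * r)%N.
Let M := #|F|.-1.
Let K := (M %/ N)%N.
Hypotheses (gamma_prim : M.-primitive_root gamma) (r_gt0 : (0 < r)%N).
Hypotheses (N_dvd : (N %| M)%N).

Definition cyclotomic_union : {set F} :=
  \bigcup_(i < L) cyclotomic_class gamma N i.

Let D := cyclotomic_union.

Let M_gt0 : (0 < M)%N. Proof. exact: prim_order_gt0 gamma_prim. Qed.

Let N_gt0 : (0 < N)%N. Proof. exact: dvdn_gt0 M_gt0 N_dvd. Qed.

Let KN : (K * N)%N = M. Proof. exact: divnK. Qed.

Let L_le_N : (L <= N)%N. Proof. by rewrite leq_pmulr. Qed.

Let h (u : 'I_L * 'I_K) : F := gamma ^+ (u.1 + u.2 * N).

Let D_imset : D = h @: setT.
Proof.
apply/setP => x; apply/bigcupP/imsetP => [[i _ /imsetP[j _ ->]]|[[i j] _ ->]].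
  by exists (i, j); rewrite ?inE.
by exists i => //; apply/imsetP; exists j; rewrite ?inE.
Qed.

Let h_inj : injective h.
Proof.
have lt_M (i : 'I_L) (j : 'I_K) : (i + j * N < M)%N.
  apply: (@leq_trans (j.+1 * N)); last by rewrite -KN leq_mul2r ltn_ord orbT.
  by rewrite mulSn ltn_add2r (leq_trans (ltn_ord i)).
have modN (i : 'I_L) (j : 'I_K) : ((i + j * N) %% N)%N = i.
  by rewrite addnC modnMDl modn_small // (leq_trans (ltn_ord i)).
have divN (i : 'I_L) (j : 'I_K) : ((i + j * N) %/ N)%N = j.
  by rewrite addnC divnMDl // divn_small ?addn0 // (leq_trans (ltn_ord i)).
move=> [i j] [i' j'] /eqP; rewrite (eq_prim_root_expr gamma_prim) !modn_small ?lt_M //=.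
move=> /eqP E; congr (_, _); apply: val_inj => /=.
  by rewrite -(modN i j) E modN.
by rewrite -(divN i j) E divN.
Qed.

Lemma sum_cyclotomic_union (R : nmodType) (G : F -> R) :
  \sum_(d in D) G d = \sum_(i < L) \sum_(j < K) G (gamma ^+ (i + j * N)).
Proof.
rewrite D_imset big_imset /=; last by move=> u v _ _; apply: h_inj.
rewrite pair_big /=; apply: eq_big => [u|u _]; first by rewrite inE.
by [].
Qed.

Lemma card_cyclotomic_union : #|D| = (L * K)%N.
Proof. by rewrite D_imset card_imset // cardsT card_prod !card_ord. Qed.

Lemma mem_cyclotomic_union b : (gamma ^+ b \in D) = (b %% N < L)%N.
Proof.
rewrite D_imset; apply/imsetP/idP => [[[i j] _ /eqP]|lt_bL].
  rewrite (eq_prim_root_expr gamma_prim) /= => /eqP E.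
  rewrite -(modn_dvdm _ N_dvd) E modn_dvdm // addnC modnMDl.
  by rewrite modn_small ?(leq_trans (ltn_ord i)).
have lt_q : (b %% M %/ N < K)%N by rewrite ltn_divLR // KN ltn_mod.
exists (Ordinal lt_bL, Ordinal lt_q); rewrite ?inE // /h /=.
apply/eqP; rewrite (eq_prim_root_expr gamma_prim) addnC.
by rewrite -(modn_dvdm b N_dvd) -divn_eq modn_mod.
Qed.

Lemma cyclotomic_union0 : 0 \notin D.
Proof.
rewrite D_imset; apply/imsetP => -[u _ /esym/eqP]; apply/negP.
by rewrite expf_neq0 // (prim_root_eq0 gamma_prim) -lt0n.
Qed.

Lemma prim_rootX x : x != 0 -> exists b, x = gamma ^+ b.
Proof.
move=> x_neq0; have /(prim_rootP gamma_prim)[b ->] : x ^+ M = 1; last by exists b.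
apply: (mulIf x_neq0).
by rewrite mul1r -exprSr prednK ?expf_card // ltnW ?finRing_gt1.
Qed.

(** As [N] divides [M] and is coprime to [p.-1], every nonzero element of the prime field is a power
    of [gamma ^+ N], and multiplication by it preserves each class. *)
Lemma cyclotomic_unionMn p n x : p \in [pchar F] -> coprime N p.-1 ->
  (0 < n < p)%N -> (x *+ n \in D) = (x \in D).
Proof.
move=> chF co_N /andP[n_gt0 lt_np].
have [->|x_neq0] := eqVneq x 0; first by rewrite mul0rn.
have n_neq0 : n%:R != 0 :> F.
  by rewrite -(dvdn_pcharf chF); apply/negP => /(dvdn_leq n_gt0); rewrite leqNgt lt_np.
have [b ->] := prim_rootX x_neq0; have [a Da] := prim_rootX n_neq0.
rewrite -mulr_natl Da -exprD !mem_cyclotomic_union.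
have /dvdnP[k ->] : (N %| a)%N; last by rewrite modnMDl.
rewrite -(Gauss_dvdl _ co_N); apply: dvdn_trans N_dvd _.
rewrite (prim_order_dvd gamma_prim) exprM -Da; apply/eqP/(mulIf n_neq0).
rewrite mul1r -exprSr prednK ?(prime_gt0 (pcharf_prime chF)) //.
by rewrite -(pFrobenius_autE chF) pFrobenius_aut_nat.
Qed.

End CyclotomicUnion.

(** * The two values of the character sums, and the theorem *)

Lemma char_sum_two_values (F : finFieldType) (psi : F -> algC) (D : {set F})
    (P w k : nat) :
  (forall x y, psi (x + y) = psi x * psi y) -> psi 0 = 1 ->
  (exists x, psi x != 1) -> (forall x, (- x \in D) = (x \in D)) -> 0 \notin D ->
  #|D| = k -> #|F| = (11 * P ^ 2)%N -> (43 * k + 1 = 11 * P ^ 2)%N ->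
  (43 * w + 21 = 11 * P)%N ->
  (forall x, x != 0 -> exists v : nat, char_sum psi D x = k%:R - (P * v)%:R) ->
  forall x, x != 0 ->
  (char_sum psi D x - (k%:R - (P * w.+1)%:R)) *
  (char_sum psi D x - (k%:R - (P * w)%:R)) = 0.
Proof.
move=> psiD psi0 psi_nontriv D_sym D0 Dk Fq Ek Ew Dv.
set a := k%:R - (P * w.+1)%:R; set b := k%:R - (P * w)%:R.
apply: Num.Theory.psumr_eq0P => [x /Dv[v ->]|].
  (* Each summand is [P ^ 2] times a product of two consecutive integers. *)
  pose t : int := w%:Z - v%:Z; pose z := (t + 1) * t.
  have z_ge0 : (0 <= z)%R.
    case: (Num.Theory.ltrP t 0) => t0; [apply: Num.Theory.mulr_le0|apply: Num.Theory.mulr_ge0];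
      by clearbody t; lia.
  have -> : (k%:R - (P * v)%:R - a) * (k%:R - (P * v)%:R - b) =
      (P ^ 2)%:R * z%:~R :> algC.
    by rewrite /z /t /a /b !(intrM, intrD, mulrNz) -addn1 !(natrM, natrD) -!pmulrn; ring.
  by rewrite Num.Theory.mulr_ge0 ?Num.Theory.ler0n ?ler0z.
have Dsum : \sum_x (char_sum psi D x - a) * (char_sum psi D x - b) =
    #|F|%:R * k%:R + #|F|%:R * (a * b).
  rewrite (eq_bigr (fun x => char_sum psi D x ^+ 2 - (a + b) * char_sum psi D x + a * b)).
    rewrite big_split sumrB -mulr_sumr /= sum_char_sum_sq // sum_char_sum // Dk.
    by rewrite sumr_const mulr0 subr0 -[a * b *+ _]mulr_natl.
  by move=> x _; ring.
(* With [k] and [w] expressed through [P], the sum over [x != 0] cancels identically. *)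
have EkC : k%:R = (11 * P%:R ^+ 2 - 1) / 43 :> algC.
  have /(congr1 (fun n => n%:R : algC)) := Ek.
  by rewrite natrD !natrM => <-; field.
have EwC : w%:R = (11 * P%:R - 21) / 43 :> algC.
  have /(congr1 (fun n => n%:R : algC)) := Ew.
  by rewrite natrD !natrM => <-; field.
move: Dsum; rewrite (bigD1 0) //= char_sum0 // Dk Fq => /(canRL (addKr _)) ->.
rewrite /a /b -addn1 !natrM !natrD EkC EwC.
by field.
Qed.

Theorem mainTheorem4 (m N f q : nat) (F : finFieldType) (gamma : {unit F})
  (hm : (1 <= m)%N)
  (hN : N = (43 ^ m)%N)
  (hf : f = (totient (43 ^ m) %/ 6)%N)
  (hq : q = (11 ^ f)%N)
  (hF : #|F| = q)
  (hgamma : generator [set: {unit F}] gamma) :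
  [/\ is_mult_order N 11 f,
      (N %| q.-1)%N
    & strongly_regular
        (Cay (\bigcup_(i < 43 ^ m.-1) cyclotomic_class (val gamma) N i))].
Proof.
case: m hm hN hf => // n _ hN hf.
have {}hf : f = (7 * 43 ^ n)%N.
  by rewrite hf totient_pfactor //= -[42%N]/(6 * 7)%N -mulnA mulKn.
have L_gt0 : (0 < 43 ^ n)%N by rewrite expn_gt0.
have f_gt0 : (0 < f)%N by rewrite hf muln_gt0.
have N_dvd : (N %| q.-1)%N.
  by rewrite hN -subn1 -eqn_mod_dvd hq ?expn_gt0 // hf expn11_eq1.
split=> //.
  split=> //; first by rewrite hN hf expn11_eq1.
  by move=> e e_gt0; rewrite hN hf => /expn11_order/(dvdn_leq e_gt0).
have hNL : N = (43 ^ n * 43)%N by rewrite hN expnSr.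
rewrite hNL /= -/(cyclotomic_union (val gamma) (43 ^ n) 43).
set D := cyclotomic_union _ _ _.
have g_prim := generator_prim_root hgamma.
have N_dvdF : (43 ^ n * 43 %| #|F|.-1)%N by rewrite hF -hNL.
have cardF : #|F| = (11 ^ f)%N by rewrite hF.
have p_pr : prime 11 by [].
have chF := card_finPcharP cardF p_pr.
have D_mul j x : (0 < j < 11)%N -> (x *+ j \in D) = (x \in D).
  by apply: cyclotomic_unionMn; rewrite // -expnSr coprimeXl.
have D_sym x : (- x \in D) = (x \in D).
  have -> : - x = x *+ 10; last exact: D_mul.
  apply/eqP; rewrite eq_sym -addr_eq0 -mulrSr -[x *+ _]mulr_natr.
  by rewrite (pcharf0 chF) mulr0.
have D0 : 0 \notin D by apply: cyclotomic_union0.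
pose c := f./2.
have Dc : f = (2 * c + 1)%N.
  rewrite /c -[LHS]odd_double_half -mul2n addnC; congr (_ + _)%N.
  by rewrite hf oddM oddX orbT.
have [psi [psiD psi1 psi_Aint]] := exists_trace_character p_pr f_gt0 cardF.
have psi0 := trace_character0 p_pr psi1.
have psi_nontriv : exists x, psi x != 1.
  by have [x tr_x] := exists_field_trace_neq0 p_pr f_gt0 cardF; exists x; rewrite psi1.
have [w Ew] : exists w, (43 * w + 21 = 11 * 11 ^ c)%N.
  (* From [2 * c + 1 = 7 * 43 ^ n] one gets [c = 3] modulo 7, and [11 ^ 4 = 21] modulo 43. *)
  exists (11 ^ c.+1 %/ 43)%N; rewrite -expnS [RHS](divn_eq _ 43) mulnC expn11_mod7.
  have -> : (c.+1 %% 7 = 4)%N by move: (43 ^ n)%N Dc hf => L' Dc' hf'; lia.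
  by rewrite modn_exp_iter.
have c_gt0 : (0 < c)%N by lia.
have Fq : #|F| = (11 * (11 ^ c) ^ 2)%N.
  by rewrite cardF Dc addn1 expnS mulnC [(2 * c)%N]mulnC expnM mulnC.
have Ek : (43 * #|D| + 1 = 11 * (11 ^ c) ^ 2)%N.
  rewrite card_cyclotomic_union // -Fq mulnA [(43 * _)%N]mulnC mulnC divnK //.
  by rewrite addn1 prednK // ltnW // finRing_gt1.
have char_sum_D x : x != 0 ->
    exists v : nat, char_sum psi D x = #|D|%:R - (11 ^ c * v)%:R.
  case/(prim_rootX g_prim) => b ->.
  apply: (char_sum_dvd p_pr f_gt0 cardF psiD psi1 psi_Aint D_mul c_gt0).
  rewrite /trace_count sum_cyclotomic_union //.
  under eq_bigr => i _ do under eq_bigr => j _ do rewrite -exprD.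
  rewrite hF hq in g_prim N_dvdF *.
  (* Here [L] is [43 ^ n], [r] is 43 and [C] is [c]. *)
  apply: (dvdn_class_trace p_pr f_gt0 cardF g_prim); first exact: divnK.
    by rewrite Dc; lia.
  by move=> j /(digit_sum11 (etrans (esym Dc) hf)); rewrite -hf.
have D1 : 1 \in D by rewrite -(expr0 (val gamma)) mem_cyclotomic_union // mod0n.
(* [43 ^ n] is the first exponent beyond the classes in [D], which gives a nonzero element outside
   [D]. *)
apply: (two_char_sums_srg psiD psi0 psi_nontriv D_sym D0 D1 (c := val gamma ^+ (43 ^ n))).
- by rewrite expf_neq0 // (prim_root_eq0 g_prim) -lt0n (prim_order_gt0 g_prim).
- by rewrite mem_cyclotomic_union // modn_small ?ltnn // ltn_Pmulr.
- exact: (char_sum_two_values psiD psi0 psi_nontriv D_sym D0 (erefl _) Fq Ek Ew char_sum_D).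
Qed.
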